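(* Let $S$ be a finite generating subset of an abelian group $G$ such that $0\in S$, $|S|\le (|G|+1)/2$ and $\kappa_2(S)\le |S|-1$. Let $H$ be a hyper-atom of $S$, and let $\phi:G\to G/H$ be the canonical morphism. Then $\phi(S)$ is either an arithmetic progression or a Vosper subset of $G/H$.
   Context: Let $S$ be a finite generating subset of an abelian group $G$ with $0\in S$. For $X\subseteq G$ put $X^S=G\setminus(X+S)$. For $k\ge1$, $\kappa_k(S)=\min\{|X+S|-|X| : X \text{ finite},\ |X|\ge k,\ |X+S|\le |G|-k\}$, with the minimum of the empty set taken to be $|G|-2k+1$. A $1$-fragment of $S$ is a finite subset $X$ with $|X|\ge 1$, $|X^S|\ge 1$ and $|X+S|-|X|=\kappa_1(S)$. A hyper-atom of $S$ is a subgroup of $G$ of maximal cardinality among the subgroups that are $1$-fragments of $S$. An arithmetic progression (with difference $d$) is a set of the form $\{a,a+d,\dots,a+jd\}$. A generating subset $S'$ of an abelian group $G'$ with $0\in S'$ is a Vosper subset if for every $X\subseteq G'$ with $|X|\ge 2$ one has $|X+S'|\ge\min(|G'|-1,|X|+|S'|)$. *)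

(* Defs.v *)
From HB Require Import structures.
From mathcomp Require Import all_boot all_order all_algebra finmap.
From mathcomp Require Import boolp classical_sets functions cardinality.
From mathcomp Require Import constructive_ereal.

Set Implicit Arguments.
Unset Strict Implicit.
Unset Printing Implicit Defensive.

Import Order.TTheory GRing.Theory Num.Theory.

Local Open Scope classical_set_scope.
Local Open Scope ring_scope.
Local Open Scope ereal_scope.

(* Every infinite set gets cardinality +oo; the value type is [\bar int] and
   not an extended type of naturals because |G| - 2k + 1 may be negative. *)
Definition ecard (T : choiceType) (A : set T) : \bar int :=
  if pselect (finite_set A) then (#|` fset_set A|%fset)%:R%:E else +oo.

(* The least element of [A], with [x0] as the minimum of the empty set. *)
Definition minimum (d : Order.disp_t) (T : porderType d) (x0 : T) (A : set T)
  : T := xget x0 (A `&` lbound A).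

Definition sumset (G : zmodType) (A B : set G) : set G :=
  [set (a + b)%R | a in A & b in B].

(* A subgroup of [G] is a [zmodClosed G]; being a boolean predicate is no
   restriction, membership being classically decidable. *)
Definition subgroup_set (G : zmodType) (H : zmodClosed G) : set G :=
  [set x | x \in H].

Definition generates (G : zmodType) (S : set G) : Prop :=
  forall K : zmodClosed G, S `<=` subgroup_set K -> forall x : G, x \in K.

Definition dual_set (G : zmodType) (S X : set G) : set G := ~` (sumset X S).

(* When G is infinite, |G| - k = +oo and |X + S| <= |G| - k always holds. *)
Definition kappa (G : zmodType) (k : nat) (S : set G) : \bar int :=
  minimum (ecard [set: G] - (2 * k)%N%:R%:E + 1)
    [set ecard (sumset X S) - ecard X | X in
       [set X : set G | [/\ finite_set X, k%:R%:E <= ecard X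
          & ecard (sumset X S) <= ecard [set: G] - k%:R%:E]]].

Definition one_fragment (G : zmodType) (S X : set G) : Prop :=
  [/\ finite_set X, 1 <= ecard X, 1 <= ecard (dual_set S X)
    & ecard (sumset X S) - ecard X = kappa 1 S].

Definition hyper_atom (G : zmodType) (S : set G) (H : zmodClosed G) : Prop :=
  one_fragment S (subgroup_set H) /\
  forall K : zmodClosed G, one_fragment S (subgroup_set K) ->
    ecard (subgroup_set K) <= ecard (subgroup_set H).

Definition arithmetic_progression (G : zmodType) (A : set G) : Prop :=
  exists (a d : G) (j : nat),
    A = [set (a + d *+ i)%R | i in [set i : nat | (i <= j)%N]].

Definition vosper (G : zmodType) (S : set G) : Prop :=
  [/\ generates S, S 0%R
    & forall X : set G, 2 <= ecard X ->
        mine (ecard [set: G] - 1) (ecard X + ecard S) <= ecard (sumset X S)].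

(* Main.v *)
(* Let [phi : G -> Q = G/H] and [T = phi(S)].  Maximality of [H] means that
   every finite subgroup [K <> 0] of [Q] with [K + T <> Q] satisfies
   [|K + T| >= |K| + |T|], and [|S| <= (|G| + 1)/2] descends to [T].
   If [T] is not a Vosper subset, some [X] with [|X| >= 2] and
   [|X + T| <= |Q| - 2] has [|X + T| < |X| + |T|].  Choose such an [A]
   containing 0 with [|A + T| - |A|] minimal, then [|A|] minimal.  By
   submodularity of [X |-> |X + T|], two distinct translates of [A] meet in at
   most one point, unless [A] is a subgroup, which is excluded.
   Let [U] be the subgroup generated by [A].  If [|A| >= 3], the same
   construction applied to [A] inside [U] would give a minimal [B] with
   [|A + B| < |A| + |B|], either a subgroup or again with almost disjoint
   translates; counting rules out both, so [|Y + A| >= |Y| + |A|] whenever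
   [Y <= U], [|Y| >= 2] and [|Y + A| <= |U| - 2].  Modulo [U], the inequality
   [|A + T| < |A| + |T|] leaves room for only one coset that [T] meets without
   filling it, and the bounds on subgroups and on [|T|] force [U = Q].  Taking
   [Y = T] excludes [|A| >= 3]; hence [A = {0, d}] with [d] generating [Q], and
   [|T + {0, d}| <= |T| + 1] makes [T] a progression. *)

Require Import Defs.
From HB Require Import structures.
From mathcomp Require Import all_boot all_order all_algebra finmap.
From mathcomp Require Import boolp classical_sets functions cardinality.
From mathcomp Require Import constructive_ereal.
From mathcomp Require Import zify.

Set Implicit Arguments.
Unset Strict Implicit.
Unset Printing Implicit Defensive.

Import Order.TTheory GRing.Theory Num.Theory.

(** * Finite sets, and lower bounds on the size of possibly infinite sets *)

Section FiniteSets.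
Local Open Scope nat_scope.
Context {T : choiceType}.
Implicit Types A B C : {fset T}.

Lemma card_sub A B : {subset A <= B} -> #|` A| <= #|` B|.
Proof. by move=> AB; apply: fsubset_leq_card; apply/fsubsetP. Qed.

Lemma sub_card_eq A B : {subset A <= B} -> #|` B| <= #|` A| -> A = B.
Proof. by move=> AB BA; apply/eqP; rewrite eqEfcard BA andbT; apply/fsubsetP. Qed.

Lemma card_disjoint A B C : {subset A <= C} -> {subset B <= C} ->
  (forall x, x \in A -> x \in B -> False) -> #|` A| + #|` B| <= #|` C|.
Proof.
move=> AC BC AB; rewrite -cardfsUI.
have -> : (A `&` B = fset0)%fset.
  by apply/fsetP => x; rewrite !inE; apply/negP => /andP[/AB].
rewrite cardfs0 addn0; apply: card_sub => x; rewrite !inE.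
by case/orP => [/AC|/BC].
Qed.

Lemma card_cover A B C : (forall x, x \in C -> x \in A \/ x \in B) ->
  #|` C| <= #|` A| + #|` B|.
Proof.
move=> AB; rewrite -cardfsUI; apply: leq_trans (leq_addr _ _).
by apply: card_sub => x /AB; rewrite !inE => -[] ->; rewrite ?orbT.
Qed.

Lemma card_gt0P A : 0 < #|` A| -> exists x, x \in A.
Proof. by rewrite cardfs_gt0 => /fset0Pn. Qed.

Lemma card_gt1P A : 1 < #|` A| -> exists x y, [/\ x \in A, y \in A & x != y].
Proof.
move=> A1; have [x xA] := card_gt0P (ltnW A1).
have : 0 < #|` A `\ x|%fset by move: A1; rewrite (cardfsD1 x) xA.
by move=> /card_gt0P[y]; rewrite !inE => /andP[yx yA]; exists y, x.
Qed.

Lemma card_gt1 A x y : x \in A -> y \in A -> x != y -> 1 < #|` A|.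
Proof.
move=> xA yA xy; have <- : #|` [fset x; y]%fset| = 2 by rewrite cardfs2 xy.
by apply: card_sub => z; rewrite !inE => /orP[] /eqP ->.
Qed.

Lemma ex_argmin (X : Type) (P : X -> Prop) (f : X -> nat) :
  (exists x, P x) -> exists2 x, P x & forall y, P y -> f x <= f y.
Proof.
move=> [x0 Px0].
have ex : exists n, `[< exists2 x, P x & f x = n >] by exists (f x0); apply/asboolP; exists x0.
have [n /asboolP[x Px fx] nmin] := ex_minnP ex.
by exists x => // y Py; rewrite fx; apply: nmin; apply/asboolP; exists y.
Qed.

(* [n <= |U|], also when [U] is infinite. *)
Definition card_ge (U : {pred T}) (n : nat) :=
  forall F : {fset T}, {subset U <= F} -> n <= #|` F|.

Lemma card_ge_le U m n : m <= n -> card_ge U n -> card_ge U m.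
Proof. by move=> mn Un F UF; apply: leq_trans mn (Un F UF). Qed.

Lemma card_geP (U : {pred T}) A : card_ge U (#|` A|).+1 ->
  exists2 x, x \in U & x \notin A.
Proof.
move=> UA; case: (pselect (exists2 x, x \in U & x \notin A)) => // nex.
suff /UA : {subset U <= A} by rewrite ltnn.
by move=> x xU; apply: contrapT => /negP xA; apply: nex; exists x.
Qed.

Lemma card_geS (U : {pred T}) A x : {subset A <= U} -> x \in U -> x \notin A ->
  card_ge U (#|` A|).+1.
Proof.
move=> AU xU xA F UF; rewrite -addn1 -(cardfs1 x); apply: card_disjoint => y.
- by move=> /AU/UF.
- by rewrite inE => /eqP ->; apply: UF.
by move=> yA; rewrite inE => /eqP e; rewrite -e yA in xA.
Qed.

(** Failing some lower bound means having a finite cover; cutting the cover down to [U] gives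
    [F]. *)
Lemma finite_card_ge (U : {pred T}) m n : card_ge U m -> ~ card_ge U n ->
  exists F : {fset T}, [/\ F =i U, m <= #|` F| & #|` F| < n].
Proof.
move=> Um /existsNP[F /not_implyP[UF /negP Fn]].
have eF : [fset x in F | x \in U]%fset =i U.
  by move=> x; rewrite !inE /=; case xU: (x \in U); rewrite ?andbF ?andbT ?(UF _ xU).
exists [fset x in F | x \in U]%fset; split=> //.
  by apply: Um => x; rewrite eF.
apply: leq_ltn_trans (_ : #|` F| < n); last by rewrite ltnNge.
by apply: card_sub => x; rewrite !inE => /andP[].
Qed.

End FiniteSets.

(** * Sumsets and translates in an abelian group *)

Section Sumsets.
Context {G : zmodType}.
Local Open Scope ring_scope.
Implicit Types (A B C S T X Y : {fset G}) (U K : {pred G}) (x y : G).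

Definition fadd A B : {fset G} := [fset (a + b)%R | a in A, b in B]%fset.
Definition translate A x : {fset G} := [fset (a + x)%R | a in A]%fset.

Lemma faddP A B z :
  reflect (exists2 a, a \in A & exists2 b, b \in B & z = a + b) (z \in fadd A B).
Proof. exact: imfset2P. Qed.

Lemma fadd_in A B a b : a \in A -> b \in B -> a + b \in fadd A B.
Proof. by move=> aA bB; apply/faddP; exists a => //; exists b. Qed.

Lemma faddC A B : fadd A B = fadd B A.
Proof.
apply/fsetP => z; apply/faddP/faddP => -[a aA [b bB ->]];
by exists b => //; exists a => //; rewrite addrC.
Qed.

Lemma fadd_subl A B C : {subset A <= B} -> {subset fadd A C <= fadd B C}.
Proof. by move=> AB z /faddP[a /AB aB [c cC ->]]; apply: fadd_in. Qed.

Lemma fadd_sub U A B : GRing.zmod_closed U -> {subset A <= U} -> {subset B <= U} ->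
  {subset fadd A B <= U}.
Proof.
move=> zU AU BU _ /faddP[a /AU aU [b /BU bU ->]].
exact: (GRing.zmod_closedD zU).2.
Qed.

Lemma mem_translate A x z : (z \in translate A x) = (z - x \in A).
Proof.
apply/imfsetP/idP => [[a aA ->]|zA]; first by rewrite addrK.
by exists (z - x) => //; rewrite subrK.
Qed.

Lemma card_translate A x : #|` translate A x| = #|` A|.
Proof. by rewrite card_imfset //=; apply: addIr. Qed.

Lemma sub_fadd_translate A B b : b \in B -> {subset translate A b <= fadd A B}.
Proof.
by move=> bB z; rewrite mem_translate => zA; rewrite -(subrK b z) fadd_in.
Qed.

Lemma fadd_translate A B x : fadd (translate A x) B = translate (fadd A B) x.
Proof.
apply/fsetP => z; rewrite mem_translate; apply/faddP/faddP => -[a aA [b bB e]].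
  exists (a - x); first by rewrite -mem_translate.
  by exists b => //; rewrite e addrAC.
exists (a + x); first by rewrite mem_translate addrK.
by exists b => //; rewrite addrAC -e subrK.
Qed.

Lemma card_fadd_gel A B b : b \in B -> (#|` A| <= #|` fadd A B|)%N.
Proof. by move=> bB; rewrite -(card_translate A b) card_sub //; apply: sub_fadd_translate. Qed.

Lemma sub_fadd0 A B : 0 \in B -> {subset A <= fadd A B}.
Proof. by move=> B0 a aA; rewrite -[a]addr0 fadd_in. Qed.

Lemma fadd0f A : fadd [fset 0%R]%fset A = A.
Proof.
apply/fsetP => x; apply/faddP/idP => [[y]|xA].
  by rewrite inE => /eqP -> [a aA ->]; rewrite add0r.
by exists 0; rewrite ?inE //; exists x; rewrite ?add0r.
Qed.

(** * Sets of minimal boundary *)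

(** Equivalently, a nonzero element is [a - b] for at most one pair from [A]. This is the Sidon
    condition in its strong form, which also rules out differences of order 2. *)
Definition sidon A := forall x, x != 0 -> (#|` A `&` translate A x|%fset <= 1)%N.

(** These are the competitors in the definition of [kappa 2], taken relative to [U]. *)
Definition separating U S X :=
  [/\ {subset X <= U}, (1 < #|` X|)%N & card_ge U (#|` fadd X S| + 2)].

Lemma separating_translate U S X x : GRing.zmod_closed U -> x \in U ->
  separating U S X -> separating U S (translate X x).
Proof.
move=> zU xU [XU X1 XS]; split; rewrite ?fadd_translate ?card_translate //.
move=> z; rewrite mem_translate => /XU zU'.
by rewrite -(subrK x z); apply: (GRing.zmod_closedD zU).2.
Qed.

(* [-(U \ (A + S))] also separates and has no larger boundary than [A], so a
   minimal [A] is no larger than the complement of [A + S]. *)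
Lemma atom_dual U S A : GRing.zmod_closed U -> {subset S <= U} ->
    separating U S A ->
    (forall Y, separating U S Y ->
      (#|` fadd Y S| + #|` A| <= #|` fadd A S| + #|` Y|)%N ->
      (#|` A| <= #|` Y|)%N) ->
  card_ge U (#|` A| + #|` fadd A S|).
Proof.
move=> zU SU [AU A1 AS2] Amin; apply: contrapT => nge.
have [F [FU F1 F2]] := finite_card_ge AS2 nge.
pose Y : {fset G} := [fset - y | y in (F `\` fadd A S)%fset]%fset.
have YP z : (z \in Y) = (z \in U) && (- z \notin fadd A S).
  have -> : (z \in U) = (- z \in F).
    rewrite FU; apply/idP/idP => /(GRing.zmod_closedN zU) //.
    by rewrite opprK.
  apply/imfsetP/idP => [[y /=]|zF].
    by rewrite inE andbC => ? ->; rewrite opprK.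
  by exists (- z); rewrite ?opprK // inE andbC.
have ASF : {subset fadd A S <= F} by move=> z; rewrite FU; apply: fadd_sub.
have cY : (#|` Y| + #|` fadd A S| = #|` F|)%N.
  rewrite card_imfset /=; last exact: oppr_inj.
  rewrite cardfsD; have -> : (F `&` fadd A S = fadd A S)%fset.
    apply/fsetP => z; rewrite inE andbC; case: (boolP (z \in fadd A S)) => // /ASF ->.
    by [].
  by rewrite subnK // card_sub.
have YU : {subset Y <= U} by move=> z; rewrite YP => /andP[].
(* [Y + S] avoids [-A]: from [y + s = -a] would follow [-y = a + s], a point of [A + S]. *)
have cYS : (#|` fadd Y S| + #|` A| <= #|` F|)%N.
  have <- : #|` [fset - a | a in A]%fset| = #|` A|.
    by rewrite card_imfset //; apply: oppr_inj.
  apply: card_disjoint.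
  - by move=> z; rewrite FU; apply: fadd_sub.
  - by move=> _ /imfsetP[a /= aA ->]; rewrite FU (GRing.zmod_closedN zU) ?AU.
  move=> z /faddP[y]; rewrite YP => /andP[_ yAS] [s sS ->] /imfsetP[a /= aA e].
  by case/negP: yAS; rewrite -[- y]opprK opprK -[- y](subrK s) -opprD e opprK fadd_in.
have sepY : separating U S Y.
  split=> //; first lia.
  by move=> F' UF'; have /card_sub : {subset F <= F'}; [move=> z; rewrite FU => /UF'|lia].
have := Amin Y sepY; lia.
Qed.

(** [A] minimises [|A + S| - |A|], then [|A|]. If [A] and [A + x] share two points, submodularity
    applied to their union and intersection, with the minimality of [|A|], forces [A + x = A]. *)
Lemma exists_atom U S X : GRing.zmod_closed U -> {subset S <= U} -> 0 \in S ->
    separating U S X ->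
  exists A, [/\ separating U S A, 0 \in A,
    (#|` fadd A S| + #|` X| <= #|` fadd X S| + #|` A|)%N
    & GRing.zmod_closed (mem A) \/ sidon A].
Proof.
move=> zU SU S0 sepX.
have leS Y : (#|` Y| <= #|` fadd Y S|)%N by apply: card_fadd_gel S0.
have [B sepB Bmin] := ex_argmin (fun Y => #|` fadd Y S| - #|` Y|)%N (ex_intro _ X sepX).
pose P Y := separating U S Y /\ (#|` fadd Y S| - #|` Y| <= #|` fadd B S| - #|` B|)%N.
have [A0 [sepA0 A0B] A0min] :=
  @ex_argmin _ P (fun Y => #|` Y|) (ex_intro _ B (conj sepB (leqnn _))).
have [a0 a0A0] := card_gt0P (ltnW (let: And3 _ h _ := sepA0 in h)).
pose A := translate A0 (- a0).
have a0U : - a0 \in U by apply: (GRing.zmod_closedN zU); case: sepA0 => + _ _; apply.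
have sepA : separating U S A by apply: separating_translate.
have A00 : 0 \in A by rewrite mem_translate opprK add0r.
have [cA cAS] : #|` A| = #|` A0| /\ #|` fadd A S| = #|` fadd A0 S|.
  by rewrite fadd_translate !card_translate.
clearbody A.
have Amin Y : separating U S Y ->
    (#|` fadd A S| + #|` Y| <= #|` fadd Y S| + #|` A|)%N.
  by move=> sepY; have := Bmin Y sepY; have := leS Y; have := leS A; have := leS B; lia.
have Amin' Y : separating U S Y ->
    (#|` fadd Y S| + #|` A| <= #|` fadd A S| + #|` Y|)%N -> (#|` A| <= #|` Y|)%N.
  move=> sepY h; rewrite cA; apply: A0min; split=> //.
  have := leS Y; have := leS A; have := leS B; lia.
have dualA := atom_dual zU SU sepA Amin'.
exists A; split=> //; first exact: Amin.
have transA x : (1 < #|` A `&` translate A x|%fset)%N -> translate A x = A.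
  move=> A2; pose I : {fset G} := (A `&` translate A x)%fset.
  pose V : {fset G} := (A `|` translate A x)%fset.
  have [AU A1 AS2] := sepA.
  have xU : x \in U.
    have [y] := card_gt0P (ltnW A2); rewrite inE mem_translate => /andP[yA yxA].
    by rewrite -[x](subKr y) zU.2 ?AU.
  have [xAU _ _] := separating_translate zU xU sepA.
  have cVI : (#|` V| + #|` I| = #|` A| + #|` A|)%N.
    by rewrite -{2}(card_translate A x) cardfsUI.
  have cVIS : (#|` fadd V S| + #|` fadd I S| <= #|` fadd A S| + #|` fadd A S|)%N.
    rewrite -{2}(card_translate (fadd A S) x) -fadd_translate.
    rewrite -(cardfsUI (fadd A S)) leq_add //.
      apply: card_sub => z /faddP[v vV [s sS ->]]; move: vV; rewrite !inE.
      by case/orP => ?; apply/orP; [left|right]; apply: fadd_in.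
    apply: card_sub => z /faddP[v vV [s sS ->]]; move: vV; rewrite !inE.
    by case/andP => ? ?; rewrite !fadd_in.
  have sepI : separating U S I.
    split=> //; first by move=> z; rewrite inE => /andP[/AU].
    apply: card_ge_le AS2; rewrite leq_add2r card_sub //.
    by apply: fadd_subl => z; rewrite inE => /andP[].
  have hI := Amin _ sepI; have I2 : (1 < #|` I|)%N by [].
  (* By submodularity [|V + S| <= |A| + |A + S| - |I|]; since [|I| >= 2], [dualA] leaves two points
     of [U] outside [V + S]. *)
  have sepV : separating U S V.
    split.
    - by move=> z; rewrite inE => /orP[/AU|/xAU].
    - by apply: leq_trans A1 _; apply: card_sub => z; rewrite inE => ->.
    by apply: card_ge_le dualA; lia.
  have hV := Amin _ sepV.
  have AI : (#|` A| <= #|` I|)%N by apply: Amin' => //; lia.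
  have eI : I = A by apply: sub_card_eq => // z; rewrite inE => /andP[].
  apply/esym/sub_card_eq; last by rewrite card_translate.
  by move=> z zA; have : z \in I by [rewrite eI]; rewrite inE => /andP[].
have [sA|nsA] := pselect (sidon A); [by right|left].
move: nsA => /existsNP[x /not_implyP[x0 /negP]]; rewrite -ltnNge => /transA Ax.
split=> // a b aA bA.
have tA z : z \in A -> z + x \in A by move=> zA; rewrite -Ax mem_translate addrK.
(* A nonzero period [x] puts both [a] and [a + x] in [A] and in [A + (a - b)], so every difference
   [a - b] is a period too and, as [0] is in [A], an element of [A]. *)
suff /transA eA : (1 < #|` A `&` translate A (a - b)|%fset)%N.
  by rewrite -eA mem_translate subrr.
apply: (@card_gt1 _ _ a (a + x)); rewrite ?inE ?mem_translate ?subKr ?aA ?bA //.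
  by rewrite tA // opprB addrC -addrA [- a + _]addrA addNr add0r tA.
by rewrite -subr_eq0 opprD addrA subrr add0r oppr_eq0.
Qed.

(** * Adding a set to a Sidon set *)

Lemma card_translateI A b c : sidon A -> b != c ->
  (#|` translate A b `&` translate A c|%fset <= 1)%N.
Proof.
move=> sA bc; apply: leq_trans (sA (c - b) _); last by rewrite subr_eq0 eq_sym.
rewrite -(card_translate (A `&` _)%fset b) card_sub // => z.
by rewrite !(inE, mem_translate) opprB addrA subrK.
Qed.

(** Two translates of [A] cover at least [2|A| - 1] points and a third adds at least [|A| - 2]. As
    [|A| >= 3], the first count suffices for [|B| = 2] and the total [3|A| - 3 >= 2|A|] for larger
    [B]. *)
Lemma sidon_fadd A B : sidon A -> (2 < #|` A|)%N -> (1 < #|` B|)%N ->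
  (#|` B| <= #|` A|)%N -> (#|` A| + #|` B| <= #|` fadd A B|)%N.
Proof.
move=> sA A2 B1 BA; have [b [c [bB cB bc]]] := card_gt1P B1.
pose V : {fset G} := (translate A b `|` translate A c)%fset.
have cV : (#|` A| + #|` A| <= #|` V| + 1)%N.
  rewrite -{1}(card_translate A b) -(card_translate A c) -cardfsUI leq_add2l.
  exact: card_translateI.
have VAB : {subset V <= fadd A B}.
  by move=> z; rewrite inE => /orP[]; apply: sub_fadd_translate.
have [B2|B2] := leqP #|` B| 2; first by have := card_sub VAB; lia.
have [d dB] : exists d, d \in (B `\` [fset b; c])%fset.
  apply: card_gt0P; rewrite cardfsD subn_gt0; apply: leq_ltn_trans B2.
  apply: leq_trans (_ : #|` [fset b; c]%fset| <= _)%N; last by rewrite cardfs2 bc.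
  by apply: card_sub => z; rewrite inE => /andP[].
move: dB; rewrite !inE negb_or => /andP[/andP[db dc] dB].
pose W : {fset G} := (V `&` translate A d)%fset.
have cW : (#|` W| <= 2)%N.
  pose W1 : {fset G} := (translate A b `&` translate A d)%fset.
  pose W2 : {fset G} := (translate A c `&` translate A d)%fset.
  have : (#|` W| <= #|` W1| + #|` W2|)%N.
    by apply: card_cover => z; rewrite !inE andb_orl => /orP.
  have : (#|` W1| <= 1)%N by apply: card_translateI => //; rewrite eq_sym.
  have : (#|` W2| <= 1)%N by apply: card_translateI => //; rewrite eq_sym.
  by lia.
have := cardfsUI V (translate A d); rewrite card_translate -/W => cU.
have : (#|` V `|` translate A d|%fset <= #|` fadd A B|)%N.
  apply: card_sub => z; rewrite inE => /orP[/VAB//|].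
  exact: sub_fadd_translate.
by lia.
Qed.

(** The bounds [2|A| - 1] and [2|B|] on [|A + B|] are averaged; integrality absorbs the missing
    half. *)
Lemma sidon_subgroup A B a c : sidon A -> GRing.zmod_closed (mem B) ->
    (1 < #|` B|)%N -> a \in A -> c \in A -> a - c \notin B ->
  (#|` A| + #|` B| <= #|` fadd A B|)%N.
Proof.
move=> sA zB B1 aA cA acB; rewrite leqNgt; apply/negP => small.
have [x [y [xB yB xy]]] := card_gt1P B1; pose b := x - y.
have bB : b \in B by apply: zB.2.
have /sA Ab1 : b != 0 by rewrite subr_eq0.
have AAB : {subset A <= fadd A B} by apply: sub_fadd0; apply: zB.1.
(* [A] minus [A + b] has at least [|A| - 1] elements; shifted by [-b] it avoids [A] and stays in
   [A + B]. *)
have hole : (#|` A `\` translate A b|%fset + #|` A| <= #|` fadd A B|)%N.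
  rewrite -(card_translate _ (- b)); apply: card_disjoint => // z.
    rewrite mem_translate inE => /andP[_ zA].
    rewrite -[z](addrK b); apply: fadd_in; first by move: zA; rewrite opprK.
    exact: (GRing.zmod_closedN zB).
  by rewrite mem_translate inE mem_translate opprK addrK => /andP[/negP].
have cosets : (#|` B| + #|` B| <= #|` fadd A B|)%N.
  rewrite -{1}(card_translate B a) -(card_translate B c) faddC.
  apply: card_disjoint => [||z]; try exact: sub_fadd_translate.
  rewrite !mem_translate => zaB zcB; case/negP: acB.
  have -> : a - c = (z - c) - (z - a) by rewrite opprB [RHS]addrC addrA subrK.
  exact: zB.2.
have : (#|` A| = #|` A `&` translate A b|%fset + #|` A `\` translate A b|%fset)%N.
  by rewrite cardfsID.
by lia.
Qed.

(** * Generated subgroups, and lower bounds inside them *)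

(** Only one inclusion: [U] lies in the subgroup generated by [A]. That [U] is a subgroup containing
    [A] is stated separately where required. *)
Definition generated U A :=
  forall K, GRing.zmod_closed K -> {subset A <= K} -> {subset U <= K}.

Lemma exists_span A : exists U,
  [/\ GRing.zmod_closed U, {subset A <= U} & generated U A].
Proof.
pose U : {pred G} := [pred x | `[< forall K, GRing.zmod_closed K -> {subset A <= K} -> x \in K >]].
exists U; split.
- split; first by apply/asboolP => K zK _; exact: zK.1.
  move=> x y /asboolP xU /asboolP yU; apply/asboolP => K zK AK.
  by apply: zK.2; [apply: xU|apply: yU].
- by move=> a aA; apply/asboolP => K _; apply.
- by move=> K zK AK x /asboolP; apply.
Qed.

Lemma translate0 X : translate X 0 = X.
Proof. by apply/fsetP => z; rewrite mem_translate subr0. Qed.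

(** Here [X + A = X], so the stabiliser of [X] is a subgroup containing [A], and therefore contains
    [U]. *)
Lemma fadd_stable U A X : generated U A -> 0 \in A ->
  (#|` fadd X A| <= #|` X|)%N -> {in U, forall u, translate X u = X}.
Proof.
move=> genU A0 XA u uU.
have eXA : X = fadd X A by apply: sub_card_eq => //; apply: sub_fadd0.
pose K : {pred G} := [pred g | translate X g == X].
suff /genU : GRing.zmod_closed K by move=> /(_ _)/(_ _ uU)/eqP; apply => a aA;
  apply/eqP/sub_card_eq; rewrite ?card_translate // {2}eXA; apply: sub_fadd_translate.
split; first by rewrite inE translate0.
move=> x y; rewrite !inE => /eqP xX /eqP yX; apply/eqP/fsetP => z.
by rewrite mem_translate -{1}yX mem_translate opprB addrA addrAC addrK -mem_translate xX.
Qed.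

(** A counterexample yields a minimal [B] for the sumsets with [A]. The larger of [A] and [B] serves
    as the Sidon set in [sidon_fadd], unless [B] is a subgroup at least as large as [A]. *)
Lemma sidon_generating U A X : GRing.zmod_closed U -> {subset A <= U} ->
    generated U A -> sidon A -> 0 \in A -> (2 < #|` A|)%N ->
  separating U A X -> (#|` X| + #|` A| <= #|` fadd X A|)%N.
Proof.
move=> zU AU genU sA A0 A2 sepX; rewrite leqNgt; apply/negP => small.
have [B [[BU B1 BA] B0 BX BB]] := exists_atom zU AU A0 sepX.
have {}small : (#|` fadd A B| < #|` A| + #|` B|)%N by rewrite faddC; lia.
have [le|/ltnW le] := leqP #|` B| #|` A|.
  by have := sidon_fadd sA A2 B1 le; lia.
case: BB => [zB|sB]; last first.
  by have := sidon_fadd sB (leq_trans A2 le) (ltnW A2) le; rewrite faddC; lia.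
(* A subgroup containing [A] contains [U], which contradicts the points of [U] left outside
   [B + A]. *)
have [AB|] := pselect {subset A <= mem B}.
  have [] := card_geP (card_ge_le _ BA : card_ge U (#|` fadd B A|).+1).
    by rewrite addn2.
  by move=> u /(genU _ zB AB) uB; rewrite (sub_fadd0 A0 uB).
move=> /existsNP[a /not_implyP[aA /negP aB]].
have := @sidon_subgroup A B a 0 sA zB B1 aA A0; rewrite subr0 => /(_ aB).
lia.
Qed.

(** A bound of Cauchy-Davenport type: weaker by one than [sidon_generating], but it covers
    [|A| = 2], singletons [X], and sumsets that miss a single point of [U]. *)
Lemma sidon_cauchy U A X : GRing.zmod_closed U -> {subset A <= U} ->
    generated U A -> sidon A -> 0 \in A -> (1 < #|` A|)%N ->
    {subset X <= U} -> (0 < #|` X|)%N -> card_ge U (#|` fadd X A|).+1 ->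
  (#|` X| + #|` A| <= (#|` fadd X A|).+1)%N.
Proof.
move=> zU AU genU sA A0 A1 XU X0 XA1.
have [x xX] := card_gt0P X0.
have XAA : (#|` A| <= #|` fadd X A|)%N by rewrite faddC (card_fadd_gel _ xX).
have [X1|X1] := leqP #|` X| 1; first lia.
have [u uU uXA] := card_geP XA1.
have [A2|A2] := leqP #|` A| 2.
  rewrite leqNgt; apply/negP => small.
  have /(fadd_stable genU A0) stX : (#|` fadd X A| <= #|` X|)%N by lia.
  case/negP: uXA; apply: sub_fadd0 => //.
  have <- : translate X (u - x) = X by apply/stX/zU.2 => //; apply: XU.
  by rewrite mem_translate subKr.
have [sepX|notsep] := pselect (card_ge U (#|` fadd X A| + 2)).
  by have := sidon_generating zU AU genU sA A0 A2 (And3 XU X1 sepX); lia.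
(* Now [|U| = |X + A| + 1]. As [u] is not in [X + A], the sets [X] and [u - A] are disjoint in
   [U]. *)
have [F [FU F1 F2]] := finite_card_ge XA1 notsep.
pose Y : {fset G} := [fset u - a | a in A]%fset.
have cY : #|` Y| = #|` A| by rewrite card_imfset // => a c /addrI /oppr_inj.
have : (#|` X| + #|` Y| <= #|` F|)%N.
  apply: card_disjoint => z.
  - by move=> /XU; rewrite FU.
  - by move=> /imfsetP[a /= aA ->]; rewrite FU; apply: zU.2 (AU _ aA).
  move=> zX /imfsetP[a /= aA e]; case/negP: uXA.
  by rewrite -(subrK a u) -e fadd_in.
by lia.
Qed.

(** * Recognising arithmetic progressions *)

(** Induction on [|T|]: removing the only first term [s] leaves a set whose only possible first term
    is [s + d]. *)
Lemma progression_of_step T s d :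
    (forall Y, (0 < #|` Y|)%N -> translate Y d = Y -> forall x, x \in Y) ->
    s \in T -> s - d \notin T ->
    (forall x, x \in T -> x - d \notin T -> x = s) ->
  forall x, x \in T <-> exists2 i, (i < #|` T|)%N & x = s + d *+ i.
Proof.
move=> fullY; move cT: #|` T| => n.
elim: n => [|n IH] in T s cT *; first by move/eqP: cT; rewrite cardfs_eq0 => /eqP ->.
move=> sT sdT sstart; pose T' : {fset G} := (T `\ s)%fset.
have cT' : #|` T'| = n by move: cT; rewrite (cardfsD1 s) sT => -[].
have T'P x : (x \in T') = (x != s) && (x \in T) by rewrite !inE.
have start x : x \in T' -> x - d \notin T' -> x = s + d.
  rewrite !T'P negb_and negbK => /andP[xs xT] /orP[/eqP <-|/(sstart _ xT) e].
    by rewrite subrK.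
  by rewrite e eqxx in xs.
have [sd|sd] := boolP (s + d \in T'); last first.
  (* Without [s + d], no element of [T'] is a first term, so [T'] is stable under [d]. If nonempty
     it would be the whole group, yet it omits [s]. *)
  suff T'0 : n = 0.
    move=> x; rewrite T'0; split=> [xT|[[|//] _ ->]]; last by rewrite addr0.
    exists 0 => //; rewrite addr0; apply/eqP; apply: contraT => xs.
    have : x \in T' by rewrite T'P xs.
    by move: cT'; rewrite T'0 => /eqP; rewrite cardfs_eq0 => /eqP ->.
  apply/eqP; rewrite -leqn0 leqNgt; apply/negP; rewrite -cT' => T'pos.
  suff : s \in T' by rewrite T'P eqxx.
  apply: fullY => //; apply/esym/sub_card_eq; last by rewrite card_translate.
  move=> x xT'; rewrite mem_translate; apply: contraT => /(start _ xT') e.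
  by rewrite -e xT' in sd.
have {}IH := IH T' (s + d) cT' sd; rewrite addrK T'P eqxx in IH.
have {}IH := IH isT start.
move=> x; split=> [xT|[[_ ->|i lin ->]]].
- have [->|xs] := eqVneq x s; first by exists 0; rewrite ?addr0.
  have /IH[i lin ->] : x \in T' by rewrite T'P xs.
  by exists i.+1; rewrite // mulrS addrA.
- by rewrite addr0.
have : s + d *+ i.+1 \in T' by apply/IH; exists i; rewrite // mulrS addrA.
by rewrite T'P => /andP[].
Qed.

(** The bound allows at most one [x] in [T] with [x - d] outside [T]. There is at least one, since
    [d] generates the group and [T] is nonempty and proper. *)
Lemma progression_of_pair T d : 0 \in T ->
    card_ge (@predT G) (#|` T|).+1 -> generated (@predT G) [fset 0%R; d]%fset ->
    (#|` fadd T [fset 0%R; d]%fset| <= (#|` T|).+1)%N ->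
  exists s j, forall x, x \in T <-> exists2 i, (i <= j)%N & x = s + d *+ i.
Proof.
move=> T0 Tproper gend cTd.
have fullY Y : (0 < #|` Y|)%N -> translate Y d = Y -> forall x, x \in Y.
  move=> /card_gt0P[y yY] Yd x.
  have stY : {in (@predT G), forall u, translate Y u = Y}.
    apply: fadd_stable gend _ _; first by rewrite !inE eqxx.
    apply: card_sub => v /faddP[z zY [b]]; rewrite !inE => /orP[]/eqP-> ->.
      by rewrite addr0.
    by rewrite -Yd mem_translate addrK.
  by rewrite -(stY (x - y)) // mem_translate subKr.
have Tpos : (0 < #|` T|)%N by rewrite cardfs_gt0; apply/fset0Pn; exists 0.
pose D : {fset G} := (T `\` translate T d)%fset.
have cD : (#|` D| <= 1)%N.
  have cU : (#|` T `|` translate T d|%fset <= #|` fadd T [fset 0%R; d]%fset|)%N.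
    apply: card_sub => x; rewrite inE => /orP[xT|].
      by apply: sub_fadd0 => //; rewrite !inE eqxx.
    by apply: sub_fadd_translate; rewrite !inE eqxx orbT.
  have := cardfsUI T (translate T d); have := cardfsID (translate T d) T.
  by rewrite card_translate -/D; lia.
have DP x : (x \in D) = (x \in T) && (x - d \notin T).
  by rewrite !inE mem_translate andbC.
have [s sD] : exists s, s \in D.
  apply: card_gt0P; rewrite lt0n; apply/eqP => /eqP; rewrite cardfs_eq0 => /eqP D0.
  have Td : translate T d = T.
    apply/esym/sub_card_eq; last by rewrite card_translate.
    move=> x xT; rewrite mem_translate; apply: contraT => xd.
    by have : x \in D; [rewrite DP xT|rewrite D0].
  by have [x _] := card_geP Tproper; rewrite (fullY T).
move: (sD); rewrite DP => /andP[sT sdT]; exists s, (#|` T|).-1 => x.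
rewrite (progression_of_step fullY sT sdT).
  by split=> -[i il e]; exists i => //; lia.
move=> y yT ydT; apply/eqP; apply: contraTT cD => ys; rewrite -ltnNge.
by apply: (card_gt1 _ sD ys); rewrite DP yT.
Qed.

(** The argument inside the quotient: [X] witnesses the failure of the Vosper property, the subgroup
    hypothesis is what maximality of the hyper-atom becomes there, and the bound on [2|T|] is
    vacuous for an infinite group. *)
Lemma progression_of_critical T X : 0 \in T -> generated (@predT G) T ->
    (forall K : {fset G}, GRing.zmod_closed (mem K) -> (1 < #|` K|)%N ->
       (exists x, x \notin fadd K T) -> (#|` K| + #|` T| <= #|` fadd K T|)%N) ->
    (forall F : {fset G}, F =i (@predT G) -> (2 * #|` T| <= (#|` F|).+1)%N) ->
    separating (@predT G) T X -> (#|` fadd X T| < #|` X| + #|` T|)%N ->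
  exists a d j, forall x, x \in T <-> exists2 i, (i <= j)%N & x = a + d *+ i.
Proof.
move=> T0 genT Ksub half sepX critX.
have zT : GRing.zmod_closed (@predT G) by [].
have [A [[_ A1 AT2] A0 AX zsA]] := exists_atom zT (fun _ _ => isT) T0 sepX.
have {AX}critA : (#|` fadd T A| < #|` T| + #|` A|)%N by rewrite faddC; lia.
have [z zTA] : exists z, z \notin fadd T A.
  rewrite faddC; have [|z _ ?] := @card_geP G (@predT G) (fadd A T); last by exists z.
  by apply: card_ge_le AT2; rewrite addn2.
case: zsA => [zA|sA].
  have := Ksub A zA A1; rewrite faddC => /(_ (ex_intro _ z zTA)); lia.
have [U [zU AU genU]] := exists_span A.
(* A finite set [UF] with the elements of [U] would be a subgroup containing
   [A], on which the hypothesis [Ksub] bounds [T + U] from below. *)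
have UFbound (F : {fset G}) : {subset U <= F} -> exists UF : {fset G},
    [/\ UF =i U, (#|` A| <= #|` UF|)%N, {subset UF <= F}
      & (exists x, x \notin fadd UF T) ->
        (#|` UF| + #|` T| <= #|` fadd UF T|)%N].
  move=> UF; pose V : {fset G} := [fset x in F | x \in U]%fset.
  have VU : V =i U by move=> x; rewrite !inE /= andbC; case: (boolP (x \in U)) => // /UF ->.
  have cAV : (#|` A| <= #|` V|)%N by apply: card_sub => x /AU; rewrite VU.
  exists V; split=> //; first by move=> x; rewrite VU => /UF.
  apply: Ksub; last exact: leq_trans A1 cAV.
  by split; [rewrite VU; apply: zU.1|move=> x y; rewrite !VU; apply: zU.2].
have TU : {subset T <= U}.
  (* If [T + A] contains all of [T + U], then [U] is finite and [|U| + |T| <= |T + A| < |T| + |A|],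
     contradicting [|A| <= |U|]. Otherwise [t + U] is a coset that [T + A] does not fill. *)
  have [[t tT [u uU tuTA]]|full] :=
    pselect (exists2 t, t \in T & exists2 u, u \in U & t + u \notin fadd T A);
    last first.
    have UTA : {subset U <= fadd T A}.
      move=> u uU; apply: contraT => uTA; case: full; exists 0 => //.
      by exists u; rewrite ?add0r.
    have [UF [UFU cUF _ UFT]] := UFbound _ UTA.
    have subTA : {subset fadd UF T <= fadd T A}.
      move=> v /faddP[u]; rewrite UFU => uU [t tT ->].
      apply: contraT => tuTA; case: full; exists t => //.
      by exists u => //; rewrite addrC.
    have : (#|` UF| + #|` T| <= #|` fadd UF T|)%N.
      by apply: UFT; exists z; apply: contra zTA => /subTA.
    by have := card_sub subTA; lia.
  pose T1 : {fset G} := [fset x in T | x - t \in U]%fset.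
  pose T2 : {fset G} := [fset x in T | x - t \notin U]%fset.
  have T1P x : (x \in T1) = (x \in T) && (x - t \in U) by rewrite !inE.
  have T2P x : (x \in T2) = (x \in T) && (x - t \notin U) by rewrite !inE.
  have cT12 : (#|` T1| + #|` T2| <= #|` T|)%N.
    apply: card_disjoint => x; rewrite ?T1P ?T2P => /andP[] // _ xt.
    by rewrite xt andbF.
  have cT21 : (#|` T| <= #|` T1| + #|` T2|)%N.
    apply: card_cover => x xT; rewrite T1P T2P xT.
    by case: (x - t \in U); [left|right].
  have tT1 : t \in T1 by rewrite T1P tT subrr zU.1.
  have T1pos : (0 < #|` T1|)%N by rewrite cardfs_gt0; apply/fset0Pn; exists t.
  have cT1A : (#|` T1| + #|` A| <= (#|` fadd T1 A|).+1)%N.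
    pose Y := translate T1 (- t).
    have YU : {subset Y <= U} by move=> x; rewrite mem_translate opprK T1P addrK => /andP[].
    have -> : #|` T1| = #|` Y| by rewrite card_translate.
    have -> : #|` fadd T1 A| = #|` fadd Y A| by rewrite fadd_translate card_translate.
    apply: (sidon_cauchy zU AU genU sA A0 A1 YU); first by rewrite card_translate.
    apply: card_geS (fadd_sub zU YU AU) uU _; apply: contra tuTA => uYA.
    apply: (@fadd_subl T1); first by move=> y; rewrite T1P => /andP[].
    by move: uYA; rewrite fadd_translate mem_translate opprK addrC.
  have cT12A : (#|` fadd T1 A| + #|` fadd T2 A| <= #|` fadd T A|)%N.
    apply: card_disjoint.
    - by apply: fadd_subl => y; rewrite T1P => /andP[].
    - by apply: fadd_subl => y; rewrite T2P => /andP[].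
    move=> x /faddP[x1]; rewrite T1P => /andP[_ x1U] [a aA ->].
    move=> /faddP[x2]; rewrite T2P => /andP[_ /negP x2U] [b bA e]; case: x2U.
    have -> : x2 - t = (x1 - t) - (b - a).
      by rewrite opprB addrAC [x1 + _]addrA e addrK.
    by apply: zU.2 => //; apply: zU.2; apply: AU.
  (* Subtracting [|T1 + A| >= |T1| + |A| - 1] from [|T + A| < |T| + |A|] leaves
     [|T2 + A| <= |T2|]. *)
  have stT2 : {in U, forall u, translate T2 u = T2}.
    by apply: (fadd_stable genU A0); lia.
  have [T20|/card_gt0P[t2 t2T2]] := posnP #|` T2|.
    have T1U x : x \in T -> x - t \in U.
      move=> xT; apply: contraT => xtU.
      by move/eqP: T20; rewrite cardfs_eq0 => /eqP T20; have : x \in T2; [rewrite T2P xT|rewrite T20].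
    move=> x /T1U xt; rewrite -(subrK t x).
    have := T1U 0 T0; rewrite sub0r => /(GRing.zmod_closedN zU); rewrite opprK => tU.
    exact: (GRing.zmod_closedD zU).2.
  have UT2 : {subset U <= translate T2 (- t2)}.
    by move=> v vU; rewrite mem_translate opprK -(stT2 v vU) mem_translate [v + _]addrC addrK.
  have [UF [UFU cUF UFsub UFT]] := UFbound _ UT2.
  have : (#|` UF| <= #|` T2|)%N by rewrite -(card_translate T2 (- t2)) card_sub.
  have cUFT : (#|` fadd UF T| <= #|` T2| + #|` UF|)%N.
    rewrite -(card_translate UF t); apply: card_cover => w /faddP[v].
    rewrite UFU => vU [y yT ->]; rewrite mem_translate UFU -addrA.
    have [yU|yU] := boolP (y - t \in U); [right|left].
      exact: (GRing.zmod_closedD zU).2.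
    by rewrite -(stT2 v vU) mem_translate addrC addKr T2P yT.
  (* [U + T] lies in the union of [T2] and [t + U]. If it is proper, [Ksub] gives [|T| <= |T2|]; if
     it is everything, [half] gives [2|T| <= 2|T2| + 1]. Both fail because [T1] is nonempty. *)
  have [[x xUF]|full] := pselect (exists x, x \notin fadd UF T).
    by have := UFT (ex_intro _ x xUF); lia.
  have : (2 * #|` T| <= (#|` fadd UF T|).+1)%N.
    by apply: half => x; apply: contraT => xF; case: full; exists x.
  by lia.
have Ufull x : x \in U by apply: genT TU _ _.
have genA : generated (@predT G) A by move=> K zK AK x _; apply: (genU _ zK AK).
have [T1|T1] := leqP #|` T| 1.
  exists 0, 0, 0 => x; split=> [xT|[i _ ->]]; last by rewrite mul0rn addr0.
  exists 0 => //; rewrite addr0; apply/eqP; apply: contraTT T1 => x0.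
  by rewrite -ltnNge (card_gt1 xT T0).
have TA2 : card_ge (@predT G) (#|` fadd T A| + 2) by rewrite faddC.
(* For [|A| >= 3], [T] itself is a separating set for [A], and the bound obtained contradicts
   [critA]. *)
have [A2|A2] := leqP #|` A| 2; last first.
  have := sidon_generating zT (fun _ _ => isT) genA sA A0 A2 (And3 (fun _ _ => isT) T1 TA2).
  by lia.
have [d dA d0] : exists2 d, d \in A & d != 0.
  have [x [y [xA yA xy]]] := card_gt1P A1.
  have [x0|x0] := eqVneq x 0; last by exists x.
  by exists y => //; rewrite -x0 eq_sym.
have eA : [fset 0%R; d]%fset = A.
  apply: sub_card_eq; last by rewrite cardfs2 eq_sym d0.
  by move=> x; rewrite !inE => /orP[]/eqP->.
have [|||s [j sj]] := @progression_of_pair T d T0; rewrite ?eA //.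
- by apply: card_ge_le TA2; rewrite addn2 !ltnS leqW // (card_fadd_gel _ A0).
- by lia.
by exists s, d, j.
Qed.
End Sumsets.

(** * From extended cardinals to finite sets *)

Section ExtendedCardinals.
Local Open Scope ereal_scope.

Lemma ecard_fset (T : choiceType) (F : {fset T}) :
  ecard [set` F]%classic = (#|` F|%:Z)%:E.
Proof.
rewrite /ecard; case: pselect => [finF|/(_ (finite_fset F))//].
by rewrite set_fsetK natz.
Qed.

Lemma ecard_full (T : choiceType) :
  (exists2 F : {fset T}, F =i predT & ecard [set: T]%classic = (#|` F|%:Z)%:E)
  \/ (forall n, card_ge (@predT T) n) /\ ecard [set: T]%classic = +oo.
Proof.
have [finT|infT] := pselect (finite_set [set: T]); [left|right].
  exists (fset_set [set: T]%classic); last by rewrite -ecard_fset fset_setK.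
  by move=> x; rewrite in_fset_set //; apply/idP/idP; rewrite in_setE.
split; last by rewrite /ecard; case: pselect.
move=> n F TF; exfalso; apply: infT; apply: (sub_finite_set _ (finite_fset F)).
by move=> x _ /=; apply: TF.
Qed.

Lemma sumset_fset (G : zmodType) (A B : {fset G}) :
  sumset [set` A] [set` B] = [set` fadd A B]%classic.
Proof.
apply/seteqP; split=> x /=.
  by move=> [a /= aA [b /= bB <-]]; apply: fadd_in.
by move=> /faddP[a aA [b bB ->]]; exists a => //; exists b.
Qed.

Lemma boundary_fset (G : zmodType) (X S : {fset G}) :
  ecard (sumset [set` X] [set` S]) - ecard [set` X]%classic =
    (#|` fadd X S|%:Z - #|` X|%:Z)%:E.
Proof. by rewrite sumset_fset !ecard_fset. Qed.

(** For infinite [G] both sides hold, the left one as a comparison with [+oo]. *)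
Lemma card_le_codim (G : zmodType) (X : {fset G}) (k : nat) :
  (ecard [set` X]%classic <= ecard [set: G] - k%:R%:E) <->
  card_ge (@predT G) (#|` X| + k).
Proof.
rewrite ecard_fset; have [[F FT ->]|[big ->]] := ecard_full G; last first.
  by split=> // _; rewrite natz /= addye // leey.
rewrite natz -EFinB lee_fin; split=> [le F' TF'|/(_ F)]; last first.
  have FF : {subset @predT G <= F} by move=> x _; rewrite FT.
  by move=> /(_ FF); lia.
have : (#|` F| <= #|` F'|)%N by apply: card_sub => x _; apply: TF'.
by lia.
Qed.

Lemma ecard_setC_ge1 (T : choiceType) (Y : {fset T}) :
  1 <= ecard (~` [set` Y])%classic <-> card_ge (@predT T) (#|` Y|).+1.
Proof.
split=> [le F TF|/card_geP[x _ xY]].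
  have [Y0|/set0P[x xY]] := eqVneq (~` [set` Y])%classic set0.
    by move: le; rewrite Y0 -set_fset0 ecard_fset cardfs0.
  by apply: (card_geS _ _ (introN idP xY)) TF.
rewrite /ecard; case: pselect => [finC|infC]; last exact: leey.
rewrite lee_fin natz lez_nat cardfs_gt0; apply/fset0Pn; exists x.
by rewrite in_fset_set //; apply: mem_set => /=; apply/negP.
Qed.

(** Since [0 \in S], boundaries are natural numbers, so the minimum is attained and [minimum] does
    not fall back on its default. *)
Lemma kappa_le (G : zmodType) (k : nat) (S X : {fset G}) : 0%R \in S ->
    (k <= #|` X|)%N -> card_ge (@predT G) (#|` fadd X S| + k) ->
  kappa k [set` S]%classic <= (#|` fadd X S|%:Z - #|` X|%:Z)%:E.
Proof.
move=> S0 kX codX.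
pose P (Y : {fset G}) := (k <= #|` Y|)%N /\ card_ge (@predT G) (#|` fadd Y S| + k).
have [Y [kY codY] Ymin] :=
  @ex_argmin _ P (fun Y => #|` fadd Y S| - #|` Y|)%N (ex_intro _ X (conj kX codX)).
have leS Z : (#|` Z| <= #|` fadd Z S|)%N by apply: card_fadd_gel S0.
rewrite /kappa /minimum; case: xgetP => [m _ [_ /(_ _)]|/(_ (#|` fadd Y S|%:Z - #|` Y|%:Z)%:E) []].
  apply; exists [set` X]%classic; last exact: boundary_fset.
  split; first exact: finite_fset.
    by rewrite ecard_fset natz lee_fin.
  by rewrite sumset_fset; apply/card_le_codim.
split.
  exists [set` Y]%classic; last exact: boundary_fset.
  split; first exact: finite_fset.
    by rewrite ecard_fset natz lee_fin.
  by rewrite sumset_fset; apply/card_le_codim.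
move=> m [Z [finZ kZ codZ] <-]; move: kZ codZ.
rewrite -(fset_setK finZ); move: (fset_set Z) => {finZ}Z.
rewrite boundary_fset sumset_fset => + /card_le_codim codZ.
rewrite ecard_fset natz lee_fin => kZ.
have := Ymin Z (conj kZ codZ); have := leS Y; have := leS Z; rewrite lee_fin; lia.
Qed.

End ExtendedCardinals.

(** * Hyper-atoms as finite sets *)

Section HyperAtoms.
Context {G : zmodType}.
Implicit Types (S X K : {fset G}) (H : zmodClosed G).

Lemma generates_fset S : generates [set` S]%classic -> generated (@predT G) S.
Proof.
move=> genS K zK SK x _.
pose KZ : zmodClosed G := HB.pack K (GRing.isZmodClosed.Build G K zK).
exact: (genS KZ).
Qed.

Lemma one_fragment_fset S X : one_fragment [set` S]%classic [set` X]%classic <->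
  [/\ (0 < #|` X|)%N, card_ge (@predT G) (#|` fadd X S|).+1
    & (#|` fadd X S|%:Z - #|` X|%:Z)%:E = kappa 1 [set` S]%classic].
Proof.
rewrite /one_fragment boundary_fset ecard_fset lee_fin /dual_set sumset_fset.
split=> [[_ X0 /ecard_setC_ge1 codX kX]|[X0 codX kX]]; split=> //.
by apply/ecard_setC_ge1.
Qed.

(** [F] attains [kappa 1]. A subgroup with boundary at most that of [F] therefore attains it too, so
    it is a fragment and the maximality of [H] bounds its size. *)
Lemma hyper_atom_fset S H : 0%R \in S -> hyper_atom [set` S]%classic H ->
  exists F : {fset G}, [/\ F =i H, card_ge (@predT G) (#|` fadd F S|).+1,
    forall X, (0 < #|` X|)%N -> card_ge (@predT G) (#|` fadd X S|).+1 ->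
      (#|` fadd F S| + #|` X| <= #|` fadd X S| + #|` F|)%N
    & forall K, GRing.zmod_closed (mem K) ->
      card_ge (@predT G) (#|` fadd K S|).+1 ->
      (#|` fadd K S| + #|` F| <= #|` fadd F S| + #|` K|)%N ->
      (#|` K| <= #|` F|)%N].
Proof.
move=> S0 [fragH maxH]; have [finH _ _ _] := fragH.
pose F := fset_set (subgroup_set H).
have FH : F =i H by move=> x; rewrite in_fset_set //; apply/idP/idP; rewrite inE.
have eF : subgroup_set H = [set` F]%classic by rewrite fset_setK.
move: fragH; rewrite eF => /one_fragment_fset[F0 codF kapF].
have Fmin X : (0 < #|` X|)%N -> card_ge (@predT G) (#|` fadd X S|).+1 ->
    (#|` fadd F S| + #|` X| <= #|` fadd X S| + #|` F|)%N.
  move=> X0 codX; have := @kappa_le G 1 S X S0 X0.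
  by rewrite addn1 -kapF => /(_ codX); rewrite lee_fin; lia.
exists F; split=> // K zK codK KF.
pose KZ : zmodClosed G := HB.pack (mem K : {pred G}) (GRing.isZmodClosed.Build G (mem K) zK).
have eK : subgroup_set KZ = [set` K]%classic by [].
have K0 : (0 < #|` K|)%N by rewrite cardfs_gt0; apply/fset0Pn; exists 0%R; exact: zK.1.
have := maxH KZ; rewrite eK eF !ecard_fset lee_fin => /(_ _)/wrap[|//].
apply/one_fragment_fset; split=> //; rewrite -kapF; congr EFin.
by have := Fmin K K0 codK; lia.
Qed.

End HyperAtoms.

(** * Preimages under a surjection with finite kernel *)

Section Fibres.
Context {G Q : zmodType} (phi : {additive G -> Q}) (r : Q -> G) (F : {fset G}).
Hypothesis phiK : cancel r phi.
Hypothesis ker_phi : forall x, (x \in F) = (phi x == 0%R).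
Local Open Scope ring_scope.
Implicit Types (Y Z : {fset Q}) (S : {fset G}).

(** The preimage of [Y] under [phi], built from the section [r] and the kernel [F] so that it is a
    finite set. *)
Definition fibres Y : {fset G} := [fset (r y + f)%R | y in Y, f in F]%fset.

Lemma mem_fibres Y x : (x \in fibres Y) = (phi x \in Y).
Proof.
apply/imfset2P/idP => [[y /= yY [f /=]]|xY].
  by rewrite ker_phi => /eqP f0 ->; rewrite raddfD phiK f0 addr0.
exists (phi x) => //; exists (x - r (phi x)); last by rewrite addrC subrK.
by rewrite /= ker_phi raddfB phiK subrr.
Qed.

Lemma card_fibres Y : #|` fibres Y| = (#|` Y| * #|` F|)%N.
Proof.
rewrite (perm_size (enum_imfset2 _ _)) /=; first exact: size_allpairs.
move=> [y f] [z g] /=.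
rewrite !inE /= !ker_phi => /andP[_ /eqP f0] /andP[_ /eqP g0] e.
have yz : y = z by have := congr1 phi e; rewrite !raddfD !phiK f0 g0 !addr0.
by move: e; rewrite yz => /addrI ->.
Qed.

Lemma fadd_fibres Y S : fadd (fibres Y) S = fibres (fadd Y [fset phi s | s in S]%fset).
Proof.
apply/fsetP => x; rewrite mem_fibres; apply/faddP/faddP => [[a aY [s sS ->]]|].
  exists (phi a); first by rewrite -mem_fibres.
  by exists (phi s); rewrite ?raddfD //; apply: in_imfset.
move=> [y yY [t /imfsetP[s /= sS ->] e]].
exists (x - s); first by rewrite mem_fibres raddfB e addrK.
by exists s; rewrite ?subrK.
Qed.

Lemma card_ge_fibres Y : card_ge (@predT Q) (#|` Y|).+1 ->
  card_ge (@predT G) (#|` fibres Y|).+1.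
Proof.
move=> /card_geP[y _ yY]; apply: (@card_geS _ _ _ (r y)) => //.
by rewrite mem_fibres phiK.
Qed.

End Fibres.

(** * The image of [S] modulo its hyper-atom *)

Section HyperAtomQuotient.
Context {G Q : zmodType} (phi : {additive G -> Q}) (r : Q -> G).
Hypothesis phiK : cancel r phi.
Local Open Scope ring_scope.

Lemma hyper_atom_quotient (S : {fset G}) (H : zmodClosed G) (X : {fset Q}) :
    0 \in S -> generated (@predT G) S ->
    (forall A : {fset G}, A =i predT -> (2 * #|` S| <= (#|` A|).+1)%N) ->
    hyper_atom [set` S]%classic H ->
    (forall x, (x \in H) = (phi x == 0)) ->
    separating (@predT Q) [fset phi s | s in S]%fset X ->
    (#|` fadd X [fset phi s | s in S]%fset|
       < #|` X| + #|` [fset phi s | s in S]%fset|)%N ->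
  exists a d j, forall x, x \in [fset phi s | s in S]%fset <->
    exists2 i, (i <= j)%N & x = a + d *+ i.
Proof.
move=> S0 genS half hyperH kerphi; set T : {fset Q} := [fset phi s | s in S]%fset.
have [F [FH codF Fmin Fmax]] := hyper_atom_fset S0 hyperH.
have kerF x : (x \in F) = (phi x == 0) by rewrite FH kerphi.
have F0 : 0 \in F by rewrite kerF raddf0.
have Fpos : (0 < #|` F|)%N by rewrite cardfs_gt0; apply/fset0Pn; exists 0.
have cfib Y : #|` fibres r F Y| = (#|` Y| * #|` F|)%N by apply: card_fibres kerF _.
have cfibS Y : #|` fadd (fibres r F Y) S| = (#|` fadd Y T| * #|` F|)%N.
  by rewrite (fadd_fibres phiK kerF) cfib.
have cFS : #|` fadd F S| = (#|` T| * #|` F|)%N.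
  have -> : F = fibres r F [fset 0%R]%fset.
    by apply/fsetP => x; rewrite (mem_fibres phiK kerF) kerF inE.
  by rewrite cfibS fadd0f cfib cardfs1 mul1n.
apply: progression_of_critical.
- by rewrite -(raddf0 phi); apply: in_imfset.
- move=> K zK TK y _; pose K' : {pred G} := [pred x | phi x \in K].
  suff : r y \in K' by rewrite inE phiK.
  apply: genS => //; first split; first by rewrite inE raddf0 zK.1.
    by move=> a b; rewrite !inE raddfB; apply: zK.2.
  by move=> s sS; rewrite inE TK //; apply: in_imfset.
(* If [|K + T| < |K| + |T|], the preimage of [K] has boundary at most [(|T| - 1)|F|], which is that
   of [F]; maximality then gives [|K||F| <= |F|], against [|K| >= 2]. *)
- move=> K zK K1 [x xKT]; rewrite leqNgt; apply/negP => small.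
  have zfib : GRing.zmod_closed (mem (fibres r F K)).
    split=> [|a b]; rewrite !(mem_fibres phiK kerF) ?raddf0; first exact: zK.1.
    by rewrite raddfB; apply: zK.2.
  have codK : card_ge (@predT G) (#|` fadd (fibres r F K) S|).+1.
    rewrite (fadd_fibres phiK kerF); apply: (card_ge_fibres phiK kerF).
    exact: card_geS xKT.
  have := Fmax _ zfib codK; rewrite cfibS cFS cfib.
  have : ((#|` fadd K T|).+1 * #|` F| <= (#|` K| + #|` T|) * #|` F|)%N by rewrite leq_mul2r small orbT.
  have : (2 * #|` F| <= #|` K| * #|` F|)%N by rewrite leq_mul2r K1 orbT.
  by rewrite mulSn mulnDl; lia.
- move=> A AT; have := half (fibres r F A).
  have full : fibres r F A =i predT by move=> x; rewrite (mem_fibres phiK kerF) AT.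
  move=> /(_ full); rewrite cfib.
  (* Comparing [F] with [{0}] gives [(|T| - 1)|F| <= |S| - 1]. Doubling and using
     [2|S| <= |Q||F| + 1] yields [2|T| - 2 < |Q|]. *)
  have := Fmin [fset 0%R]%fset; rewrite fadd0f cardfs1 cFS => /(_ isT) hF.
  have /hF : card_ge (@predT G) (#|` S|).+1.
    apply: card_ge_le codF; rewrite ltnS faddC; exact: card_fadd_gel F0.
  by nia.
Qed.

Lemma hyper_atom_progression_or_vosper (S : {fset G}) (H : zmodClosed G)
    (T := [fset phi s | s in S]%fset : {fset Q}) :
    0 \in S -> generates [set` S]%classic ->
    (forall A : {fset G}, A =i predT -> (2 * #|` S| <= (#|` A|).+1)%N) ->
    hyper_atom [set` S]%classic H ->
    (forall x, (x \in H) = (phi x == 0)) ->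
  arithmetic_progression [set` T]%classic \/ vosper [set` T]%classic.
Proof.
move=> S0 genS half hyperH kerphi.
have [|nvosper] := pselect (vosper [set` T]%classic); [by right|left].
have genT : generates [set` T]%classic.
  move=> K TK y; rewrite -(phiK y).
  have zK : GRing.zmod_closed ([pred x | phi x \in K] : {pred G}).
    split; first by rewrite inE raddf0 rpred0.
    by move=> a b; rewrite !inE raddfB; apply: rpredB.
  apply: (generates_fset genS zK) => // s sS; rewrite inE; apply: TK => /=.
  exact: in_imfset.
(* A set violating the Vosper inequality is finite: since [0] is in [T], an infinite [X] has an
   infinite sumset, which satisfies it. *)
have [X [finX X2 critX]] : exists X : set Q, [/\ finite_set X,
    (2 <= ecard X)%E & ~ (mine (ecard [set: Q]%classic - 1)
      (ecard X + ecard [set` T]%classic) <= ecard (sumset X [set` T]%classic))%E].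
  apply: contrapT => nex; apply: nvosper; split=> //.
    by rewrite /= -(raddf0 phi); apply: in_imfset.
  move=> X X2; apply: contrapT => critX; apply: nex; exists X; split=> //.
  apply: contrapT => infX; apply: critX.
  rewrite [leRHS]/ecard; case: pselect => [finXT|infXT]; last exact: leey.
  exfalso; apply: infX; apply: sub_finite_set finXT => x xX.
  exists x => //; exists 0%R; last exact: addr0.
  by rewrite /= -(raddf0 phi); apply: in_imfset.
have [Y eX] : exists Y : {fset Q}, X = [set` Y]%classic by exists (fset_set X); rewrite fset_setK.
move: X2 critX; rewrite {}eX => {X finX}; move: Y => X.
rewrite sumset_fset !ecard_fset -EFinD => X2 /negP; rewrite -ltNge lt_min.
move=> /andP[codX critX].
(* The strict inequality [|X + T| < |Q| - 1] between integers supplies the two missing points. *)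
have sepX : separating predT T X.
  split=> //.
  have [[A AT eA]|[big _]] := ecard_full Q; last exact: big.
  move: codX; rewrite eA -EFinB lte_fin => codX A' TA'.
  have : (#|` A| <= #|` A'|)%N by apply: card_sub => x _; apply: TA'.
  by lia.
have {}critX : (#|` fadd X T| < #|` X| + #|` T|)%N by move: critX; rewrite lte_fin; lia.
have [a [d [j adj]]] :=
  hyper_atom_quotient S0 (generates_fset genS) half hyperH kerphi sepX critX.
exists a, d, j; apply/seteqP; split=> x /=.
  by move=> /adj[i ij ->]; exists i.
by move=> [i /= ij <-]; apply/adj; exists i.
Qed.

End HyperAtomQuotient.

Local Open Scope classical_set_scope.
Local Open Scope ring_scope.
Local Open Scope ereal_scope.
Local Open Scope quotient_scope.

Theorem theorem3p3 (G : zmodType) (S : set G) (H : zmodClosed G)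
  (finS : finite_set S) (genS : generates S) (S0 : S 0%R)
  (cardS : 2 * ecard S <= ecard [set: G] + 1)
  (kappaS : kappa 2 S <= ecard S - 1)
  (hyperH : hyper_atom S H) :
  arithmetic_progression (\pi_(Quotient.quot H) @` S) \/ vosper (\pi_(Quotient.quot H) @` S).
Proof.
move: S finS genS S0 cardS hyperH {kappaS} => S0 finS.
rewrite -(fset_setK finS); move: (fset_set S0) => {S0 finS}S genS S0 cardS hyperH.
pose Q : zmodType := Quotient.quot H.
pose phi : {additive G -> Q} := \pi_(Quotient.quot H).
have -> : \pi_(Quotient.quot H) @` [set` S] = [set` ([fset phi s | s in S]%fset : {fset Q})].
  apply/seteqP; split=> x /=.
    by move=> [s /= sS <-]; apply/imfsetP; exists s.
  by move=> /imfsetP[s /= sS ->]; exists s.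
have {cardS} half (A : {fset G}) : A =i predT -> (2 * #|` S| <= (#|` A|).+1)%N.
  move=> AT; have eA : [set: G] = [set` A].
    by apply/seteqP; split=> x //= _; rewrite AT.
  move: cardS; rewrite eA !ecard_fset -EFinM -EFinD lee_fin; lia.
(* Choosing a representative in each coset provides the section used to build preimages. *)
have phiK : cancel repr phi by move=> x; apply: reprK.
have kerphi x : (x \in H) = (phi x == 0%R).
  by rewrite -(raddf0 phi) /phi /= -[x in LHS]subr0 Quotient.idealrBE.
exact: (hyper_atom_progression_or_vosper phiK S0 genS half hyperH kerphi).
Qed.
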